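(* Let $(\mathcal A,\mu,\alpha)$ be a Hom-associative superalgebra, $(V,\mathfrak l,\mathfrak r,\beta)$ a representation of it, and $T:V\to\mathcal A$ an anti-super-$\mathcal O$-operator on $(\mathcal A,\mu,\alpha)$ associated with $(V,\mathfrak l,\mathfrak r,\beta)$. Define two binary operations $\prec_T,\succ_T$ on $V$ by $$u\prec_T v=-\mathfrak l(T(u))v,\qquad u\succ_T v=-(-1)^{|u||v|}\mathfrak r(T(v))u$$ for homogeneous $u,v\in V$. Then $(V,\prec_T,\succ_T,\beta)$ is a Hom-anti-dendriform superalgebra if and only if $T$ is strong. In this case, $T$ is a homomorphism of Hom-associative superalgebras from $(V,\cdot_T,\beta)$ to $(\mathcal A,\mu,\alpha)$, where $u\cdot_T v=u\prec_T v+u\succ_T v$. Furthermore, there is an induced Hom-anti-dendriform superalgebra structure on $T(V)=\{T(u): u\in V\}\subseteq\mathcal A$ (with twisting map the restriction of $\alpha$) given by $$T(u)\prec T(v)=T(u\prec_T v),\qquad T(u)\succ T(v)=T(u\succ_T v),\qquad u,v\in V.$$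
   Context: All vector spaces are finite-dimensional over a field $\mathbb F$ of characteristic $0$ and $\mathbb Z_2$-graded; $|x|$ is the degree of a homogeneous element; all identities are required for homogeneous elements. A Hom-associative superalgebra is $(\mathcal A,\mu,\alpha)$ with $\mu:\mathcal A\times\mathcal A\to\mathcal A$ even bilinear, $\alpha:\mathcal A\to\mathcal A$ even linear and $\mu(\mu(x,y),\alpha(z))=\mu(\alpha(x),\mu(y,z))$. A homomorphism of Hom-associative superalgebras is an even linear map preserving products and intertwining the twisting maps. A representation (bimodule) of $(\mathcal A,\mu,\alpha)$ is $(V,\mathfrak l,\mathfrak r,\beta)$ with $\beta:V\to V$ even linear and $\mathfrak l,\mathfrak r:\mathcal A\to \mathrm{End}(V)$ even linear such that for all $x,y$: $\beta\mathfrak l(x)=\mathfrak l(\alpha(x))\beta$; $\beta\mathfrak r(x)=\mathfrak r(\alpha(x))\beta$; $\mathfrak l(\mu(x,y))\beta=\mathfrak l(\alpha(x))\mathfrak l(y)$; $\mathfrak r(\mu(x,y))\beta=(-1)^{|x||y|}\mathfrak r(\alpha(y))\mathfrak r(x)$; $\mathfrak l(\alpha(x))\mathfrak r(y)=(-1)^{|x||y|}\mathfrak r(\alpha(y))\mathfrak l(x)$. An anti-super-$\mathcal O$-operator associated with $(V,\mathfrak l,\mathfrak r,\beta)$ is an even linear map $T:V\to\mathcal A$ with $T\circ\beta=\alpha\circ T$ and $\mu(T(u),T(v))=-T\big(\mathfrak l(T(u))v+(-1)^{|u||v|}\mathfrak r(T(v))u\big)$ for all $u,v\in V$. It is strong if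 $\mathfrak l(\mu(T(u),T(v)))\beta(w)=(-1)^{|u|(|v|+|w|)}\mathfrak r(\mu(T(v),T(w)))\beta(u)$ for all $u,v,w\in V$. A Hom-anti-dendriform superalgebra is $(\mathcal A,\prec,\succ,\alpha)$ with $\prec,\succ$ even bilinear, $\alpha$ even linear such that, with $x\cdot y=x\prec y+x\succ y$: $\alpha(x)\prec(y\prec z)=-(x\cdot y)\prec\alpha(z)=-\alpha(x)\succ(y\cdot z)=(x\succ y)\succ\alpha(z)$ and $(x\prec y)\succ\alpha(z)=\alpha(x)\prec(y\succ z)$. *)

(* Defs.v *)
From HB Require Import structures.
From mathcomp Require Import all_boot all_order all_algebra.

Set Implicit Arguments.
Unset Strict Implicit.
Unset Printing Implicit Defensive.

Import GRing.Theory.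
Local Open Scope ring_scope.

(* Degrees in Z_2 are booleans ([true] is the odd degree): [(+)] is the sum in
   Z_2, and degrees coerce to 0 or 1 in the exponent of a sign.  "x is
   homogeneous of degree i" is [x \in gr V i], so that 0 has both degrees. *)
Record superSpace (F : fieldType) := SuperSpace {
  super_sort :> vectType F;
  gr : bool -> {vspace super_sort};
  gr_cap : (gr false :&: gr true = 0)%VS;
  gr_sum : (gr false + gr true = fullv)%VS
}.
Arguments gr {F} V i : rename.

(* The homogeneous component of degree i of a vector. *)
Definition hpart (F : fieldType) (V : superSpace F) (i : bool) : 'End(V) :=
  daddv_pi (gr V i) (gr V (~~ i)).

Definition even_map (F : fieldType) (V W : superSpace F) (f : 'Hom(V, W)) :
    Prop :=
  forall i v, v \in gr V i -> f v \in gr W i.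

Definition even_op (F : fieldType) (V : superSpace F) (op : V -> V -> V) :
    Prop :=
  forall i j u v, u \in gr V i -> v \in gr V j -> op u v \in gr V (i (+) j).

(* Evenness for the grading of End(V) in which the maps of degree i are those
   sending [gr V j] into [gr V (i (+) j)]. *)
Definition even_action (F : fieldType) (A V : superSpace F)
    (l : 'Hom(A, 'End(V))) : Prop :=
  forall i j x v, x \in gr A i -> v \in gr V j -> l x v \in gr V (i (+) j).

Record hom_assoc (F : fieldType) (A : superSpace F)
    (mu : A -> A -> A) (alpha : 'End(A)) : Prop := HomAssoc {
  hom_assoc_bilinear : bilinear_for *:%R *:%R mu;
  hom_assoc_even : even_op mu;
  hom_assoc_twist_even : even_map alpha;
  hom_assocE : forall i j k x y z,
    x \in gr A i -> y \in gr A j -> z \in gr A k ->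
    mu (mu x y) (alpha z) = mu (alpha x) (mu y z)
}.

Record hom_assoc_morphism (F : fieldType) (A B : superSpace F)
    (muA : A -> A -> A) (alphaA : 'End(A))
    (muB : B -> B -> B) (alphaB : 'End(B)) (f : 'Hom(A, B)) : Prop :=
  HomAssocMorphism {
  morphism_even : even_map f;
  morphism_mul : forall x y, f (muA x y) = muB (f x) (f y);
  morphism_twist : forall x, f (alphaA x) = alphaB (f x)
}.

Record representation (F : fieldType) (A : superSpace F)
    (mu : A -> A -> A) (alpha : 'End(A)) (V : superSpace F)
    (l r : 'Hom(A, 'End(V))) (beta : 'End(V)) : Prop := Representation {
  rep_twist_even : even_map beta;
  rep_left_even : even_action l;
  rep_right_even : even_action r;
  rep_twist_left : forall i x, x \in gr A i ->
    (beta \o l x = l (alpha x) \o beta)%VF;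
  rep_twist_right : forall i x, x \in gr A i ->
    (beta \o r x = r (alpha x) \o beta)%VF;
  rep_left_mul : forall i j x y, x \in gr A i -> y \in gr A j ->
    (l (mu x y) \o beta = l (alpha x) \o l y)%VF;
  rep_right_mul : forall i j x y, x \in gr A i -> y \in gr A j ->
    (r (mu x y) \o beta)%VF = (-1) ^+ (i * j) *: (r (alpha y) \o r x)%VF;
  rep_left_right : forall i j x y, x \in gr A i -> y \in gr A j ->
    (l (alpha x) \o r y)%VF = (-1) ^+ (i * j) *: (r (alpha y) \o l x)%VF
}.

Record anti_O_operator (F : fieldType) (A : superSpace F)
    (mu : A -> A -> A) (alpha : 'End(A)) (V : superSpace F)
    (l r : 'Hom(A, 'End(V))) (beta : 'End(V)) (T : 'Hom(V, A)) : Prop :=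
  AntiOOperator {
  anti_O_even : even_map T;
  anti_O_twist : (T \o beta = alpha \o T)%VF;
  anti_O_mul : forall i j u v, u \in gr V i -> v \in gr V j ->
    mu (T u) (T v) = - T (l (T u) v + (-1) ^+ (i * j) *: r (T v) u)
}.

Definition strong (F : fieldType) (A : superSpace F) (mu : A -> A -> A)
    (V : superSpace F) (l r : 'Hom(A, 'End(V))) (beta : 'End(V))
    (T : 'Hom(V, A)) : Prop :=
  forall i j k u v w, u \in gr V i -> v \in gr V j -> w \in gr V k ->
    l (mu (T u) (T v)) (beta w) =
    (-1) ^+ (i * (j + k)) *: r (mu (T v) (T w)) (beta u).

Record anti_dendriform (F : fieldType) (A : superSpace F)
    (prec succ : A -> A -> A) (alpha : 'End(A)) : Prop := AntiDendriform {
  anti_dend_prec_bilinear : bilinear_for *:%R *:%R prec;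
  anti_dend_succ_bilinear : bilinear_for *:%R *:%R succ;
  anti_dend_prec_even : even_op prec;
  anti_dend_succ_even : even_op succ;
  anti_dend_twist_even : even_map alpha;
  anti_dend_chain : forall i j k x y z,
    x \in gr A i -> y \in gr A j -> z \in gr A k ->
    [/\ prec (alpha x) (prec y z) = - prec (prec x y + succ x y) (alpha z),
        - prec (prec x y + succ x y) (alpha z) =
          - succ (alpha x) (prec y z + succ y z)
      & - succ (alpha x) (prec y z + succ y z) = succ (succ x y) (alpha z)];
  anti_dend_mixed : forall i j k x y z,
    x \in gr A i -> y \in gr A j -> z \in gr A k ->
    succ (prec x y) (alpha z) = prec (alpha x) (succ y z)
}.

Definition precT (F : fieldType) (A V : superSpace F) (l : 'Hom(A, 'End(V)))
    (T : 'Hom(V, A)) (u v : V) : V := - l (T u) v.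

(* The sign depends on degrees, so the operation is extended bilinearly from
   homogeneous vectors; [succT_homog] below is the defining formula. *)
Definition succT (F : fieldType) (A V : superSpace F) (r : 'Hom(A, 'End(V)))
    (T : 'Hom(V, A)) (u v : V) : V :=
  \sum_(i : bool) \sum_(j : bool)
    - ((-1) ^+ (i * j) *: r (T (hpart V j v)) (hpart V i u)).

Definition dotT (F : fieldType) (A V : superSpace F) (l r : 'Hom(A, 'End(V)))
    (T : 'Hom(V, A)) (u v : V) : V := precT l T u v + succT r T u v.

Section HomogeneousParts.

Variables (F : fieldType) (V : superSpace F).

Lemma gr_capN i : (gr V i :&: gr V (~~ i) = 0)%VS.
Proof. by case: i => /=; [rewrite capvC|]; apply: gr_cap. Qed.

Lemma hpart_id i v : v \in gr V i -> hpart V i v = v.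
Proof. by move=> vi; rewrite /hpart daddv_pi_id // gr_capN. Qed.

Lemma hpart_eq0 i v : v \in gr V i -> hpart V (~~ i) v = 0.
Proof.
move=> vi; have vs : v \in (gr V i + gr V (~~ i))%VS.
  by apply: subvP vi; apply: addvSl.
have := daddv_pi_add (gr_capN i) vs.
rewrite (daddv_pi_id (gr_capN i) vi) /hpart negbK.
by move/(canRL (addKr _)); rewrite addNr.
Qed.

End HomogeneousParts.

Lemma succT_homog (F : fieldType) (A V : superSpace F)
    (r : 'Hom(A, 'End(V))) (T : 'Hom(V, A)) (i j : bool) (u v : V) :
  u \in gr V i -> v \in gr V j ->
  succT r T u v = - ((-1) ^+ (i * j) *: r (T v) u).
Proof.
move=> ui vj; rewrite /succT (bigD1 i) //= [X in _ + X]big1 ?addr0; last first.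
  move=> k /negPf ki; rewrite big1 // => m _.
  have -> : k = ~~ i by case: k i ki {ui} => [] [].
  by rewrite hpart_eq0 // linear0 scaler0 oppr0.
rewrite (bigD1 j) //= [X in _ + X]big1 ?addr0; last first.
  move=> k /negPf kj; have -> : k = ~~ j by case: k j kj {vj} => [] [].
  by rewrite (hpart_eq0 vj) !linear0 zero_lfunE scaler0 oppr0.
by rewrite !hpart_id.
Qed.

Section ImageSuperSpace.

Variables (F : fieldType) (V A : superSpace F) (T : 'Hom(V, A)).
Hypothesis evT : even_map T.

Definition img_gr (i : bool) : {vspace subvs_of (limg T)} :=
  (linfun (vsval : subvs_of (limg T) -> A) @^-1: gr A i)%VS.

Lemma mem_img_gr i x : (x \in img_gr i) = (vsval x \in gr A i).
Proof. by rewrite -memv_preim lfunE. Qed.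

Lemma img_gr_cap : (img_gr false :&: img_gr true = 0)%VS.
Proof.
apply/eqP; rewrite -subv0; apply/subvP => x.
rewrite memv_cap !mem_img_gr -memv_cap gr_cap !memv0 => /eqP x0.
by apply/eqP/val_inj.
Qed.

Lemma img_gr_sum : (img_gr false + img_gr true = fullv)%VS.
Proof.
apply/eqP; rewrite eqEsubv subvf; apply/subvP => x _.
have /memv_imgP[v _ xE] := subvsP x.
have : v \in (gr V false + gr V true)%VS by rewrite gr_sum memvf.
case/memv_addP => v0 v0g [v1 v1g vE].
apply/memv_addP; exists (vsproj (limg T) (T v0)).
  by rewrite mem_img_gr vsprojK ?memv_img ?memvf // evT.
exists (vsproj (limg T) (T v1)).
  by rewrite mem_img_gr vsprojK ?memv_img ?memvf // evT.
apply: val_inj => /=.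
by rewrite !vsprojK ?memv_img ?memvf // -linearD -vE.
Qed.

(* T(V), graded by its intersections with the homogeneous components of A. *)
Definition imgSuper : superSpace F := SuperSpace img_gr_cap img_gr_sum.

Definition incl (x : imgSuper) : A := vsval (x : subvs_of (limg T)).

Definition toImg (u : V) : imgSuper := vsproj (limg T) (T u).

Lemma incl_toImg u : incl (toImg u) = T u.
Proof. by rewrite /incl vsprojK // memv_img ?memvf. Qed.

End ImageSuperSpace.

(* Main.v *)
Require Import Defs.
From mathcomp Require Import all_boot all_order all_algebra.

Set Implicit Arguments.
Unset Strict Implicit.
Unset Printing Implicit Defensive.

Import GRing.Theory.
Local Open Scope ring_scope.

(** Write [u . v] for [dotT l r T u v].  The defining identity of an
    anti-super-O-operator says exactly that [T (u . v) = mu (T u) (T v)]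
    ([anti_O_dotT]); it is given on homogeneous vectors and extends to all of
    them by bilinearity.  With it, and with the representation axioms, each of
    the four expressions in the chain of anti-dendriform identities becomes an
    action of a product in [A] on a twisted vector:
      - both [beta u < (v < w)] and [- (u . v) < beta w] are
        [l (mu (T u) (T v)) (beta w)], by the left module axiom and the
        multiplicativity of [T] respectively;
      - both [- beta u > (v . w)] and [(u > v) > beta w] are
        [(-1) ^ (|u| (|v| + |w|)) r (mu (T v) (T w)) (beta u)], by the
        multiplicativity of [T] and the right module axiom respectively.
    The first and the last equality of the chain thus always hold, and the
    middle one is the strongness of [T].  The mixed identity is the
    compatibility of the left and right actions and also always holds.  This
    is [anti_dendriform_strongP].

    In any Hom-anti-dendriform superalgebra the sum of the two operations is
    Hom-associative, because the four members of the chain cancel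
    ([anti_dendriform_hom_assoc]); for [dotT] this makes [T] a homomorphism.

    For the image, what is at stake is that [T (u < v)] and [T (u > v)] depend
    only on [T u] and [T v].  The vector [u < v] depends on [u] only through
    [T u], and [u > v] depends on [v] only through [T v].  Hence, if
    [T v = 0], then [u > v = 0], and [T (u < v) = mu (T u) (T v) = 0]
    ([T_precT_ker]).  So [T (u < v)] is well defined on the image, and so is
    [T (u > v)], the difference between [mu (T u) (T v)] and it.  The
    operations on [T(V)] are computed on the preimages given by a linear
    section of [T], and inherit the axioms from [V] because [V] maps onto
    [T(V)] in each degree ([anti_dendriform_quotient]). *)

(** * Bilinear operations *)

Section Bilinear.

Variables (F : fieldType) (U V W : vectType F) (b : U -> V -> W).
Hypothesis bil_b : bilinear_for *:%R *:%R b.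

Lemma bilinear_addl y x x' : b (x + x') y = b x y + b x' y.
Proof. by case: bil_b => bl _; have /= := bl y 1 x x'; rewrite !scale1r. Qed.

Lemma bilinear_addr x y y' : b x (y + y') = b x y + b x y'.
Proof. by case: bil_b => _ br; have /= := br x 1 y y'; rewrite !scale1r. Qed.

Lemma bilinear_0r x : b x 0 = 0.
Proof. by apply: (addIr (b x 0)); rewrite -bilinear_addr !add0r. Qed.

Lemma bilinear_subr x y y' : b x (y - y') = b x y - b x y'.
Proof. by apply/eqP; rewrite eq_sym subr_eq -bilinear_addr subrK. Qed.

End Bilinear.

(** * Homogeneous decompositions *)

Lemma hpart_mem (F : fieldType) (V : superSpace F) i (v : V) :
  hpart V i v \in gr V i.
Proof. exact: memv_pi. Qed.

Lemma hpart_sum (F : fieldType) (V : superSpace F) i (v : V) :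
  v = hpart V i v + hpart V (~~ i) v.
Proof.
rewrite /hpart negbK daddv_pi_add ?gr_capN //.
by case: i => /=; rewrite ?[(gr V true + _)%VS]addvC gr_sum memvf.
Qed.

(** An even map commutes with the projections on homogeneous components, since
    it sends the decomposition of a vector to the decomposition of its image. *)
Lemma even_map_hpart (F : fieldType) (V W : superSpace F) (f : 'Hom(V, W)) :
  even_map f -> forall i v, f (hpart V i v) = hpart W i (f v).
Proof.
move=> evf i v; rewrite [in RHS](hpart_sum i v) !linearD /=.
have fh k : f (hpart V k v) \in gr W k by apply: evf; apply: hpart_mem.
rewrite (hpart_id (fh i)); have := hpart_eq0 (fh (~~ i)).
by rewrite negbK => ->; rewrite addr0.
Qed.

(** Identities whose signs depend on degrees are available on homogeneous
    vectors only; this removes the restriction once the signs are absorbed in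
    bilinear operations. *)
Lemma bilinear_homog_ext (F : fieldType) (V : superSpace F) (W : vectType F)
    (b c : V -> V -> W) :
  bilinear_for *:%R *:%R b -> bilinear_for *:%R *:%R c ->
  (forall i j u v, u \in gr V i -> v \in gr V j -> b u v = c u v) ->
  forall u v, b u v = c u v.
Proof.
have bil_sum (d : V -> V -> W) : bilinear_for *:%R *:%R d -> forall u v,
    d u v = d (hpart V false u) (hpart V false v)
          + d (hpart V false u) (hpart V true v)
          + (d (hpart V true u) (hpart V false v)
          + d (hpart V true u) (hpart V true v)).
  move=> bd u v; rewrite [in LHS](hpart_sum false u) [in LHS](hpart_sum false v).
  by rewrite (bilinear_addl bd) !(bilinear_addr bd).
move=> bb bc bcE u v; rewrite (bil_sum b bb) (bil_sum c bc).
by congr (_ + _ + (_ + _)); apply: bcE; apply: hpart_mem.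
Qed.

Lemma sign_congr (R : pzRingType) m n :
  odd m = odd n -> (-1) ^+ m = (-1) ^+ n :> R.
Proof. by move=> mn; rewrite -[LHS]signr_odd mn signr_odd. Qed.

(** * Hom-anti-dendriform superalgebras *)

(** With [c] the common value of the chain, both sides of Hom-associativity
    reduce to the two sides of the mixed identity: the products with a sum in
    one argument contribute [- c], which the remaining term [c] cancels. *)
Lemma anti_dendriform_hom_assoc (F : fieldType) (A : superSpace F)
    (prec succ : A -> A -> A) (alpha : 'End(A)) :
  anti_dendriform prec succ alpha ->
  hom_assoc (fun x y => prec x y + succ x y) alpha.
Proof.
case=> hp hs pe se ae chain mixed; split=> //.
- split=> [y c x x'|x c y y'] /=; case: hp hs => pl pr [sl sr].
    by rewrite pl sl /= scalerDr addrACA.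
  by rewrite pr sr /= scalerDr addrACA.
- by move=> i j u v ui vj; rewrite memvD ?pe ?se.
move=> i j k x y z xi yj zk.
have [e1 e2 e3] := chain _ _ _ _ _ _ xi yj zk.
rewrite (bilinear_addl hs) (bilinear_addr hp).
rewrite (mixed _ _ _ _ _ _ xi yj zk) -e3 -e2 e1.
rewrite -[succ (alpha x) _]opprK -e2 opprK.
by rewrite addrCA subrr addr0 addrAC addNr add0r.
Qed.

(** A homogeneous element of [W] lifts to a homogeneous element of [V] of the
    same degree, namely the component in that degree of any preimage; every
    axiom is then the image under [f] of the one in [V]. *)
Lemma anti_dendriform_quotient (F : fieldType) (V W : superSpace F)
    (f : 'Hom(V, W)) (prec succ : V -> V -> V) (beta : 'End(V))
    (prec' succ' : W -> W -> W) (beta' : 'End(W)) :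
  even_map f ->
  (forall x, exists u, f u = x) ->
  (forall u v, prec' (f u) (f v) = f (prec u v)) ->
  (forall u v, succ' (f u) (f v) = f (succ u v)) ->
  (forall u, beta' (f u) = f (beta u)) ->
  anti_dendriform prec succ beta -> anti_dendriform prec' succ' beta'.
Proof.
move=> fe fsurj fp fs fb [[pl pr] [sl sr] pe se be chain mixed].
have fhom i x : x \in gr W i -> exists2 u, u \in gr V i & f u = x.
  move=> xi; have [u ux] := fsurj x; exists (hpart V i u).
    exact: hpart_mem.
  by rewrite even_map_hpart // ux hpart_id.
split.
- split=> [y c x x'|x c y y'] /=; have [u <-] := fsurj x;
    have [v <-] := fsurj y.
    by have [u' <-] := fsurj x'; rewrite -(linearP f) !fp pl (linearP f).
  by have [v' <-] := fsurj y'; rewrite -(linearP f) !fp pr (linearP f).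
- split=> [y c x x'|x c y y'] /=; have [u <-] := fsurj x;
    have [v <-] := fsurj y.
    by have [u' <-] := fsurj x'; rewrite -(linearP f) !fs sl (linearP f).
  by have [v' <-] := fsurj y'; rewrite -(linearP f) !fs sr (linearP f).
- move=> i j x y /fhom[u ui <-] /fhom[v vj <-].
  by rewrite fp; apply: fe; apply: pe.
- move=> i j x y /fhom[u ui <-] /fhom[v vj <-].
  by rewrite fs; apply: fe; apply: se.
- by move=> i x /fhom[u ui <-]; rewrite fb; apply: fe; apply: be.
- move=> i j k x y z /fhom[u ui <-] /fhom[v vj <-] /fhom[w wk <-].
  have [e1 e2 e3] := chain _ _ _ _ _ _ ui vj wk.
  by split; rewrite !(fb, fp, fs, =^~ linearD, =^~ linearN) ?e1 ?e2 ?e3.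
move=> i j k x y z /fhom[u ui <-] /fhom[v vj <-] /fhom[w wk <-].
by rewrite !(fb, fp, fs) (mixed _ _ _ _ _ _ ui vj wk).
Qed.

(** * The operations defined by an anti-super-O-operator *)

Section OperatorProducts.

Variables (F : fieldType) (A : superSpace F).
Variables (mu : A -> A -> A) (alpha : 'End(A)).
Variables (V : superSpace F) (l r : 'Hom(A, 'End(V))) (beta : 'End(V)).
Variable T : 'Hom(V, A).
Hypothesis hA : hom_assoc mu alpha.
Hypothesis hV : representation mu alpha l r beta.
Hypothesis hT : anti_O_operator mu alpha l r beta T.

Let evT : even_map T := anti_O_even hT.

Lemma anti_O_twistE u : T (beta u) = alpha (T u).
Proof. by have /lfunP/(_ u) := anti_O_twist hT; rewrite !lfunE. Qed.

Lemma precT_bilinear : bilinear_for *:%R *:%R (precT l T).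
Proof.
split=> [v c u u'|u c v v'] /=; rewrite /precT.
  by rewrite !linearP /= !lfunE /= !lfunE /= opprD scalerN.
by rewrite linearP opprD scalerN.
Qed.

Lemma succT_bilinear : bilinear_for *:%R *:%R (succT r T).
Proof.
split=> [v c u u'|u c v v'] /=; rewrite /succT scaler_sumr -big_split /=;
  apply: eq_bigr => i _; rewrite scaler_sumr -big_split /=;
  apply: eq_bigr => j _.
  by rewrite !linearP /= scalerN -opprD.
rewrite !linearP /= !lfunE /= !lfunE /= scalerDr opprD scalerN.
by rewrite !scalerA mulrC.
Qed.

Lemma precT_even : even_op (precT l T).
Proof.
by move=> i j u v ui vj; rewrite memvN (rep_left_even hV) ?evT.
Qed.

Lemma succT_even : even_op (succT r T).
Proof.
move=> i j u v ui vj; rewrite (succT_homog _ _ ui vj) memvN memvZ //.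
by rewrite addbC (rep_right_even hV) ?evT.
Qed.

Lemma anti_O_dotT u v : T (dotT l r T u v) = mu (T u) (T v).
Proof.
have [pl pr] := precT_bilinear; have [sl sr] := succT_bilinear.
have [ml mr] := hom_assoc_bilinear hA.
pose b u v := T (dotT l r T u v); pose c u v := mu (T u) (T v).
apply: (@bilinear_homog_ext _ _ _ b c) => {u v}.
- split=> [v a u u'|u a v v']; rewrite /b /dotT /=.
    by rewrite pl sl addrACA -scalerDr linearP.
  by rewrite pr sr addrACA -scalerDr linearP.
- split=> [v a u u'|u a v v']; rewrite /c /= linearP.
    by rewrite ml.
  by rewrite mr.
move=> i j u v ui vj; rewrite /b /c (anti_O_mul hT ui vj) /dotT /precT.
by rewrite (succT_homog _ _ ui vj) -opprD linearN.
Qed.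

Lemma succT_ker u v : T v = 0 -> succT r T u v = 0.
Proof.
move=> v0; rewrite /succT big1 // => i _; rewrite big1 // => j _.
by rewrite even_map_hpart // v0 !linear0 zero_lfunE scaler0 oppr0.
Qed.

(** The operator identity would also contain the term in [r (T v) u], but this
    vanishes along with [T v], so only the left action remains. *)
Lemma T_precT_ker u v : T v = 0 -> T (precT l T u v) = 0.
Proof.
move=> v0; have := anti_O_dotT u v; rewrite /dotT succT_ker // addr0 => ->.
by rewrite v0 (bilinear_0r (hom_assoc_bilinear hA)).
Qed.

Lemma T_precT_congr u v u' v' :
  T u = T u' -> T v = T v' -> T (precT l T u v) = T (precT l T u' v').
Proof.
move=> eu ev; rewrite {1}/precT eu -/(precT l T u' v); apply/eqP.
rewrite -subr_eq0 -(linearB T) -(bilinear_subr precT_bilinear).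
by apply/eqP/T_precT_ker; rewrite linearB /= ev subrr.
Qed.

(** While [succT r T u v] depends on [u] itself, its image under [T] is the
    difference between [mu (T u) (T v)] and [T (precT l T u v)]. *)
Lemma T_succT_congr u v u' v' :
  T u = T u' -> T v = T v' -> T (succT r T u v) = T (succT r T u' v').
Proof.
have dotB x y : T (succT r T x y) = mu (T x) (T y) - T (precT l T x y).
  by rewrite -anti_O_dotT /dotT linearD addrAC subrr add0r.
by move=> eu ev; rewrite !dotB (T_precT_congr eu ev) eu ev.
Qed.

Lemma precT_precT i j k u v w : u \in gr V i -> v \in gr V j -> w \in gr V k ->
  precT l T (beta u) (precT l T v w) = l (mu (T u) (T v)) (beta w).
Proof.
move=> ui vj wk; rewrite /precT linearN opprK anti_O_twistE.
have /lfunP/(_ w) := rep_left_mul hV (evT ui) (evT vj).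
by rewrite !lfunE.
Qed.

Lemma precT_dotT u v w :
  precT l T (dotT l r T u v) (beta w) = - l (mu (T u) (T v)) (beta w).
Proof. by rewrite /precT anti_O_dotT. Qed.

Lemma dotT_even : even_op (dotT l r T).
Proof.
by move=> i j u v ui vj; rewrite memvD ?precT_even ?succT_even.
Qed.

(** The sign is the degree sign of [succT], the second argument having degree
    [j + k]; it is the sign in the definition of strong operators. *)
Lemma succT_dotT i j k u v w : u \in gr V i -> v \in gr V j -> w \in gr V k ->
  succT r T (beta u) (dotT l r T v w) =
  - ((-1) ^+ (i * (j + k)) *: r (mu (T v) (T w)) (beta u)).
Proof.
move=> ui vj wk.
rewrite (succT_homog _ _ (rep_twist_even hV ui) (dotT_even vj wk)) anti_O_dotT.
by congr (- (_ *: _)); apply: sign_congr; case: i j k {ui vj wk} => [] [] [].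
Qed.

(** The two uses of [succT] give the sign of exponent [i j + (i + j) k], and
    the right module axiom one of exponent [j k]: together
    [i (j + k)] modulo 2. *)
Lemma succT_succT i j k u v w : u \in gr V i -> v \in gr V j -> w \in gr V k ->
  succT r T (succT r T u v) (beta w) =
  (-1) ^+ (i * (j + k)) *: r (mu (T v) (T w)) (beta u).
Proof.
move=> ui vj wk.
rewrite (succT_homog _ _ (succT_even ui vj) (rep_twist_even hV wk)).
rewrite (succT_homog _ _ ui vj) linearN scalerN opprK anti_O_twistE.
have /lfunP/(_ u) := rep_right_mul hV (evT vj) (evT wk).
rewrite !lfunE /= !lfunE /= => ->; rewrite linearZ /= !scalerA.
rewrite -!exprD; congr (_ *: _); apply: sign_congr.
by case: i j k {ui vj wk} => [] [] [].
Qed.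

(** Compatibility of the actions moves [r] past [l] at the cost of the sign of
    exponent [i k], the difference between the signs of the two sides. *)
Lemma succT_precT i j k u v w : u \in gr V i -> v \in gr V j -> w \in gr V k ->
  succT r T (precT l T u v) (beta w) = precT l T (beta u) (succT r T v w).
Proof.
move=> ui vj wk.
rewrite (succT_homog _ _ (precT_even ui vj) (rep_twist_even hV wk)).
rewrite (succT_homog _ _ vj wk) /precT !linearN /= !opprK.
rewrite !anti_O_twistE linearZ /=.
have /lfunP/(_ v) := rep_left_right hV (evT ui) (evT wk).
rewrite !lfunE /= !lfunE /= => ->; rewrite !scalerA.
rewrite -!exprD; congr (_ *: _); apply: sign_congr.
by case: i j k {ui vj wk} => [] [] [].
Qed.

(** Only the middle equality of the chain is not automatic, and it equates the
    two sides of the strong condition. *)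
Lemma anti_dendriform_strongP :
  anti_dendriform (precT l T) (succT r T) beta <-> strong mu l r beta T.
Proof.
split=> [[_ _ _ _ _ chain _] i j k u v w ui vj wk | hS].
  have [_ e2 e3] := chain _ _ _ _ _ _ ui vj wk.
  rewrite -(succT_succT ui vj wk) -e3 -e2.
  by rewrite -/(dotT l r T u v) precT_dotT opprK.
split; [exact: precT_bilinear|exact: succT_bilinear|exact: precT_even
       |exact: succT_even|exact: rep_twist_even hV| |exact: succT_precT].
move=> i j k u v w ui vj wk.
rewrite -/(dotT l r T u v) -/(dotT l r T v w) (precT_precT ui vj wk) precT_dotT.
by rewrite (succT_dotT ui vj wk) (succT_succT ui vj wk) !opprK
           (hS _ _ _ _ _ _ ui vj wk).
Qed.

End OperatorProducts.

(** * The structure carried by the image *)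

Section ImageStructure.

Variables (F : fieldType) (V A : superSpace F) (T : 'Hom(V, A)).
Hypothesis evT : even_map T.

Definition img_proj : 'Hom(V, imgSuper evT) :=
  (linfun (vsproj (limg T)) \o T)%VF.

(** The preimages are chosen linearly so that the twisting map of the image,
    which is computed on them, is an endomorphism. *)
Definition img_lift : 'Hom(imgSuper evT, V) :=
  (T^-1 \o linfun (vsval : subvs_of (limg T) -> A))%VF.

Lemma img_projE u : img_proj u = toImg evT u.
Proof. by rewrite lfunE /= lfunE. Qed.

Lemma img_liftK x : T (img_lift x) = incl x.
Proof. by rewrite lfunE /= lfunE /= limg_lfunVK //; apply: subvsP. Qed.

Lemma img_proj_eq u v : T u = T v -> img_proj u = img_proj v.
Proof. by rewrite !img_projE /toImg => ->. Qed.

Lemma img_proj_lift x : img_proj (img_lift x) = x.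
Proof.
by apply: val_inj; rewrite img_projE -[LHS]/(incl _) incl_toImg img_liftK.
Qed.

Lemma T_lift_proj u : T (img_lift (img_proj u)) = T u.
Proof. by rewrite img_liftK img_projE incl_toImg. Qed.

Lemma img_proj_even : even_map img_proj.
Proof.
move=> i u ui; rewrite mem_img_gr img_projE -[vsval _]/(incl _) incl_toImg.
exact: evT.
Qed.

End ImageStructure.

Theorem proposition3p3 (F : fieldType) (char0 : [pchar F] =i pred0)
    (A : superSpace F) (mu : A -> A -> A) (alpha : 'End(A))
    (hA : hom_assoc mu alpha)
    (V : superSpace F) (l r : 'Hom(A, 'End(V))) (beta : 'End(V))
    (hV : representation mu alpha l r beta)
    (T : 'Hom(V, A)) (hT : anti_O_operator mu alpha l r beta T) :
  (anti_dendriform (precT l T) (succT r T) beta <-> strong mu l r beta T) /\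
  (strong mu l r beta T ->
     [/\ hom_assoc (dotT l r T) beta,
         hom_assoc_morphism (dotT l r T) beta mu alpha T
       & let TV := imgSuper (anti_O_even hT) in
         let pi : V -> TV := toImg (anti_O_even hT) in
         exists (prec succ : TV -> TV -> TV) (alphaTV : 'End(TV)),
           [/\ forall x : TV, incl (alphaTV x) = alpha (incl x),
               anti_dendriform prec succ alphaTV,
               forall u v : V, prec (pi u) (pi v) = pi (precT l T u v)
             & forall u v : V, succ (pi u) (pi v) = pi (succT r T u v)]]).
Proof.
have strongP := anti_dendriform_strongP hA hV hT.
split=> // hS; have dendT := strongP.2 hS; split.
- exact: anti_dendriform_hom_assoc dendT.
- split; [exact: anti_O_even hT|exact: anti_O_dotT hA hT|].
  exact: anti_O_twistE hT.
move=> TV pi; pose p := img_proj (anti_O_even hT).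
pose s := img_lift (anti_O_even hT).
pose precI (x y : TV) : TV := p (precT l T (s x) (s y)).
pose succI (x y : TV) : TV := p (succT r T (s x) (s y)).
pose alphaI : 'End(TV) := (p \o beta \o s)%VF.
have precI_p u v : precI (p u) (p v) = p (precT l T u v).
  by apply/img_proj_eq/(T_precT_congr hA hT); apply: T_lift_proj.
have succI_p u v : succI (p u) (p v) = p (succT r T u v).
  by apply/img_proj_eq/(T_succT_congr hA hT); apply: T_lift_proj.
have alphaIE x : alphaI x = p (beta (s x)) by rewrite /alphaI !comp_lfunE.
exists precI, succI, alphaI; split.
- move=> x; rewrite alphaIE /p img_projE incl_toImg (anti_O_twistE hT).
  by rewrite img_liftK.
- apply: (anti_dendriform_quotient (f := p)) dendT => //.
  + exact: img_proj_even.
  + by move=> x; exists (s x); apply: img_proj_lift.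
  move=> u; rewrite alphaIE; apply: img_proj_eq.
  by rewrite !(anti_O_twistE hT) T_lift_proj.
- by move=> u v; rewrite /pi -!img_projE precI_p.
by move=> u v; rewrite /pi -!img_projE succI_p.
Qed.
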